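(* Let $f\in\mathcal{W}$ be convex. Then for any integer $m\ge 1$ and any real numbers $a_1\ge a_2\ge\dots\ge a_{2m}\ge 0$, $$ f\left(\sum_{s=1}^{2m}(-1)^{s-1}a_s\right)\le \sum_{s=1}^{2m}(-1)^{s-1}f(a_s). $$
   Context: $\mathcal{W}$ denotes the class of all functions $f:[0,\infty)\to\mathbb{R}$ such that $f(x)-f(y)\ge f(x-y)$ for all $x\ge y\ge 0$; equivalently, $f(x+y)\ge f(x)+f(y)$ for all $x\ge y\ge 0$. *)

(* Defs.v *)
From HB Require Import structures.
From mathcomp Require Import all_boot all_order all_algebra.
From mathcomp Require Import classical_sets set_interval reals convex.

Set Implicit Arguments.
Unset Strict Implicit.
Unset Printing Implicit Defensive.

Import Order.TTheory GRing.Theory Num.Theory.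
Local Open Scope ring_scope.

(* A function [0, oo) -> R is represented by a total f : R -> R whose values at
   negative arguments are irrelevant: x, y and x - y below are nonnegative. *)
Definition classW (R : realType) (f : R -> R) : Prop :=
  forall x y : R, 0 <= y -> y <= x -> f (x - y) <= f x - f y.

(* Main.v *)
Require Import Defs.
From HB Require Import structures.
From mathcomp Require Import all_boot all_order all_algebra.
From mathcomp Require Import classical_sets set_interval reals convex.
From mathcomp Require Import interval_inference ring lra.

Set Implicit Arguments.
Unset Strict Implicit.
Unset Printing Implicit Defensive.

Import Order.TTheory GRing.Theory Num.Theory.
Local Open Scope ring_scope.

(** For a convex function the increment over an interval of fixed length grows
    as the interval moves to the right, so a pair [a1 >= a2] may be slid to the
    left: if [0 <= t <= a2] then
    [f (t + (a1 - a2)) - f t <= f a1 - f a2].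
    The alternating sum [t] of the terms after the first two is such a point,
    since an alternating sum of a nonincreasing nonnegative sequence lies
    between [0] and its first term, here [a3 <= a2]. Adding the inequality for
    the shorter sum to the slid increment gives the inequality for the whole
    sum, by induction on the number of pairs; for a single pair it is the
    defining inequality of the class [classW]. *)

Lemma convex_function_segment (R : realType) (f : R -> R) (x y l : R) :
  @convex_function R R^o `[0, +oo[%classic f ->
  0 <= x -> 0 <= y -> 0 <= l -> l <= 1 ->
  f (l * x + (1 - l) * y) <= l * f x + (1 - l) * f y.
Proof.
move=> f_convex x0 y0 l0 l1.
have l01 : Itv.spec (@Itv.num_sem R) (Itv.Real `[0%Z, 1%Z]) l.
  by rewrite /= /Itv.num_sem /= realE l0 /= in_itv /= l0 l1.
have xD : x \in `[0, +oo[%classic by rewrite inE /= in_itv /= x0.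
have yD : y \in `[0, +oo[%classic by rewrite inE /= in_itv /= y0.
exact: (f_convex (Itv.mk l01) x y xD yD).
Qed.

(** Both inner points [t + d] and [y] of [[t, y + d]] are convex combinations
    of its endpoints, with swapped weights; adding the two convexity
    inequalities, the weights sum to one. *)
Lemma convex_function_increment_le (R : realType) (f : R -> R) (t y d : R) :
  @convex_function R R^o `[0, +oo[%classic f ->
  0 <= t -> t <= y -> 0 <= d ->
  f (t + d) - f t <= f (y + d) - f y.
Proof.
move=> f_convex t0 ty d0.
have [->|d_neq0] := eqVneq d 0; first by rewrite !addr0 !subrr.
have dgt0 : 0 < d by rewrite lt_neqAle eq_sym d_neq0.
have Lgt0 : 0 < y + d - t by lra.
have L_neq0 : y + d - t != 0 by rewrite gt_eqF.
pose l := (y - t) / (y + d - t).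
have l0 : 0 <= l by rewrite divr_ge0 //; lra.
have l1 : l <= 1 by rewrite ler_pdivrMr //; lra.
have yd0 : 0 <= y + d by lra.
have := convex_function_segment f_convex t0 yd0 l0 l1.
have := convex_function_segment f_convex yd0 t0 l0 l1.
have -> : l * (y + d) + (1 - l) * t = y by rewrite /l; field.
have -> : l * t + (1 - l) * (y + d) = t + d by rewrite /l; field.
lra.
Qed.

Lemma alternating_sum_recl2 (R : pzRingType) (b : nat -> R) (n : nat) :
  \sum_(s < n.+2) (-1) ^+ s * b s =
  b 0%N - b 1%N + \sum_(s < n) (-1) ^+ s * b s.+2.
Proof.
rewrite 2!big_ord_recl /= expr0 expr1 mul1r mulN1r addrA; congr (_ + _).
by apply: eq_bigr => i _; rewrite !exprS !mulN1r opprK.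
Qed.

(** The bounds on the alternating sum are part of the induction: they place the
    tail where [convex_function_increment_le] applies. The first pair is split
    off, so the tail is the same statement for the sequence shifted by two. *)
Lemma convex_classW_alternating_sum (R : realType) (f : R -> R)
    (b : nat -> R) (p : nat) :
  classW f -> @convex_function R R^o `[0, +oo[%classic f ->
  (forall s, (s < p.*2.+1)%N -> b s.+1 <= b s) -> 0 <= b p.*2.+1 ->
  let S := \sum_(s < p.*2.+2) (-1) ^+ s * b s in
  [/\ 0 <= S, S <= b 0%N & f S <= \sum_(s < p.*2.+2) (-1) ^+ s * f (b s)].
Proof.
move=> f_W f_convex; elim: p b => [|p IHp] b b_noninc b_last /=;
  rewrite (alternating_sum_recl2 b) (alternating_sum_recl2 (f \o b)) /=.
  have b10 : b 1%N <= b 0%N by exact: b_noninc.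
  rewrite !big_ord0 !addr0; split; [lra|lra|exact: f_W].
have [//| //|T0 Tb fT] := IHp (fun s => b s.+2).
  by move=> s sp; apply: b_noninc; rewrite doubleS !ltnS.
have b10 : b 1%N <= b 0%N by exact: b_noninc.
have b21 : b 2%N <= b 1%N by exact: b_noninc.
rewrite doubleS; move: T0 Tb fT.
set T := \sum_(s < _) _ * b _; set U := \sum_(s < _) _ * f _ => T0 Tb fT.
split; [lra|lra|].
have d0 : 0 <= b 0%N - b 1%N by lra.
have := convex_function_increment_le f_convex T0 (le_trans Tb b21) d0.
rewrite [T + _]addrC [b 1%N + _]addrC subrK; lra.
Qed.

Theorem theorem2p14 (R : realType) (f : R -> R)
    (f_W : classW f)
    (f_convex : @convex_function R R^o `[0, +oo[%classic f)
    (m : nat) (m_ge1 : (1 <= m)%N) (a : nat -> R)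
    (a_noninc : forall s : nat, (1 <= s < 2 * m)%N -> a s.+1 <= a s)
    (a_last_ge0 : 0 <= a (2 * m)%N) :
  f (\sum_(1 <= s < (2 * m).+1) (-1) ^+ (s - 1) * a s)
    <= \sum_(1 <= s < (2 * m).+1) (-1) ^+ (s - 1) * f (a s).
Proof.
case: m m_ge1 a_noninc a_last_ge0 => // p _.
rewrite mul2n doubleS => a_noninc a_last_ge0.
have reindex (g : nat -> R) : \sum_(1 <= s < p.*2.+3) (-1) ^+ (s - 1) * g s =
    \sum_(s < p.*2.+2) (-1) ^+ s * g s.+1.
  by rewrite big_add1 big_mkord; apply: eq_bigr => i _; rewrite subn1.
rewrite (reindex a) (reindex (f \o a)).
have [//|//|_ _ //] :=
  convex_classW_alternating_sum (b := a \o succn) (p := p) f_W f_convex.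
by move=> s sp; apply: a_noninc.
Qed.
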